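(* Let $L$ be a distributive lattice of subgroups of an abelian group $A$, with meet $\cap$ and join $+$. For any finite family $I_{0},\ldots,I_{n}$ of members of $L$ the canonical diagram $$A\Big/\bigcap_{\alpha=0}^{n}I_{\alpha}\;\longrightarrow\;\prod_{\alpha=0}^{n}A/I_{\alpha}\;\rightrightarrows\;\prod_{\alpha,\beta=0}^{n}A/(I_{\alpha}+I_{\beta})$$ is an equalizer. Here the first arrow sends the class of $a$ to $(a+I_\alpha)_{\alpha}$, and the two parallel arrows send $(a_\alpha+I_\alpha)_\alpha$ to $(a_\alpha+I_\alpha+I_\beta)_{\alpha,\beta}$ and to $(a_\beta+I_\alpha+I_\beta)_{\alpha,\beta}$, respectively.
   Context: A lattice $L$ of subgroups of an abelian group $A$ is a set of subgroups of $A$ closed under intersection $\cap$ (meet) and sum $+$ (join). It is distributive if $I_0+(I_1\cap I_2)=(I_0+I_1)\cap(I_0+I_2)$ for all $I_0,I_1,I_2\in L$ (equivalently, $I_0\cap(I_1+I_2)=(I_0\cap I_1)+(I_0\cap I_2)$ for all $I_0,I_1,I_2\in L$). *)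

(* Defs.v *)
From HB Require Import structures.
From mathcomp Require Import all_boot all_algebra.
From mathcomp Require Import boolp classical_sets.

Set Implicit Arguments.
Unset Strict Implicit.
Unset Printing Implicit Defensive.

Import GRing.Theory.
Local Open Scope ring_scope.
Local Open Scope quotient_scope.

(* A subgroup of the abelian group A is an inhabitant of zmodClosed A, i.e. a  *)
(* boolean predicate on A containing 0 and closed under addition and opposite; *)
(* the quotient group A / I is {ideal_quot I}, which only needs I to be a      *)
(* subgroup despite its name.                                                  *)

Section Subgroups.
Variable A : zmodType.
Implicit Types I J : zmodClosed A.

Definition cap_pred I J : A -> bool := fun x => (x \in I) && (x \in J).

Lemma cap_zmod_closed I J : zmod_closed (cap_pred I J).
Proof.
split=> [|x y]; first by apply/andP; split; apply: rpred0.
by move=> /andP[xI xJ] /andP[yI yJ]; apply/andP; split; apply: rpredB.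
Qed.

HB.instance Definition _ I J :=
  GRing.isZmodClosed.Build A (cap_pred I J) (cap_zmod_closed I J).

Definition subg_cap I J : zmodClosed A :=
  GRing.ZmodClosed.clone A (cap_pred I J) _.

Definition sum_pred I J : A -> bool :=
  fun x => `[< exists y z, [/\ y \in I, z \in J & x = y + z] >].

Lemma sum_zmod_closed I J : zmod_closed (sum_pred I J).
Proof.
split=> [|x x'].
  by apply/asboolP; exists 0, 0; rewrite !rpred0 addr0.
move=> /asboolP[y [z [yI zJ ->]]] /asboolP[y' [z' [yI' zJ' ->]]].
apply/asboolP; exists (y - y'), (z - z'); split; try exact: rpredB.
by rewrite opprD addrACA.
Qed.

HB.instance Definition _ I J :=
  GRing.isZmodClosed.Build A (sum_pred I J) (sum_zmod_closed I J).

Definition subg_sum I J : zmodClosed A :=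
  GRing.ZmodClosed.clone A (sum_pred I J) _.

Definition bigcap_pred (K : finType) (I : K -> zmodClosed A) : A -> bool :=
  fun x => [forall k, x \in I k].

Lemma bigcap_zmod_closed (K : finType) (I : K -> zmodClosed A) :
  zmod_closed (bigcap_pred I).
Proof.
split=> [|x y].
  by apply/forallP => k; apply: rpred0.
move=> /forallP xI /forallP yI; apply/forallP => k.
by apply: rpredB; [apply: xI | apply: yI].
Qed.

HB.instance Definition _ (K : finType) (I : K -> zmodClosed A) :=
  GRing.isZmodClosed.Build A (bigcap_pred I) (bigcap_zmod_closed I).

Definition subg_bigcap (K : finType) (I : K -> zmodClosed A) : zmodClosed A :=
  GRing.ZmodClosed.clone A (bigcap_pred I) _.

Lemma subg_bigcap_sub (K : finType) (I : K -> zmodClosed A) (k : K) :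
  {subset subg_bigcap I <= I k}.
Proof. by move=> x /forallP/(_ k). Qed.

Lemma subg_sum_subl I J : {subset I <= subg_sum I J}.
Proof.
by move=> x xI; apply/asboolP; exists x, 0; rewrite addr0 rpred0.
Qed.

Lemma subg_sum_subr I J : {subset J <= subg_sum I J}.
Proof.
by move=> x xJ; apply/asboolP; exists 0, x; rewrite add0r rpred0.
Qed.

Definition subgroup_lattice (L : set (zmodClosed A)) : Prop :=
  (forall I J, L I -> L J -> L (subg_cap I J)) /\
  (forall I J, L I -> L J -> L (subg_sum I J)).

Definition distributive_lattice (L : set (zmodClosed A)) : Prop :=
  forall I0 I1 I2, L I0 -> L I1 -> L I2 ->
    subg_sum I0 (subg_cap I1 I2)
      =i subg_cap (subg_sum I0 I1) (subg_sum I0 I2).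

End Subgroups.

Section Product.
Variables (K : Type) (V : K -> zmodType).

Definition zprod : Type := forall k, V k.

HB.instance Definition _ := gen_eqMixin zprod.
HB.instance Definition _ := gen_choiceMixin zprod.

Definition zprod_zero : zprod := fun=> 0.
Definition zprod_opp (f : zprod) : zprod := fun k => - f k.
Definition zprod_add (f g : zprod) : zprod := fun k => f k + g k.

Lemma zprod_addA : associative zprod_add.
Proof. by move=> f g h; apply: functional_extensionality_dep => k; apply: addrA. Qed.

Lemma zprod_addC : commutative zprod_add.
Proof. by move=> f g; apply: functional_extensionality_dep => k; apply: addrC. Qed.

Lemma zprod_add0 : left_id zprod_zero zprod_add.
Proof. by move=> f; apply: functional_extensionality_dep => k; apply: add0r. Qed.

Lemma zprod_addN : left_inverse zprod_zero zprod_opp zprod_add.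
Proof. by move=> f; apply: functional_extensionality_dep => k; apply: addNr. Qed.

HB.instance Definition _ := GRing.isZmodule.Build zprod
  zprod_addA zprod_addC zprod_add0 zprod_addN.

End Product.

(* The equalizer property in the category of abelian groups. *)
Definition is_equalizer (E X Y : zmodType)
    (e : {additive E -> X}) (f g : {additive X -> Y}) : Prop :=
  f \o e =1 g \o e /\
  forall (T : zmodType) (h : {additive T -> X}), f \o h =1 g \o h ->
    exists2 k : {additive T -> E}, e \o k =1 h &
      forall k' : {additive T -> E}, e \o k' =1 h -> k' =1 k.

Section QuotientMap.
Variables (A : zmodType) (I J : zmodClosed A) (sIJ : {subset I <= J}).

(* The homomorphism a + I |-> a + J induced by I <= J, computed on a chosen    *)
(* representative; see quot_map_pi.                                            *)
Definition quot_map of {subset I <= J} : {ideal_quot I} -> {ideal_quot J} :=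
  fun x => \pi_({ideal_quot J}) (repr x).

Lemma quot_map_pi (a : A) :
  quot_map sIJ (\pi_({ideal_quot I}) a) = \pi_({ideal_quot J}) a.
Proof.
apply/eqP; rewrite -Quotient.idealrBE; apply: sIJ.
by rewrite Quotient.idealrBE reprK.
Qed.

Lemma quot_map_zmod_morphism : zmod_morphism (quot_map sIJ).
Proof.
move=> x y; rewrite -[x]reprK -[y]reprK -raddfB !quot_map_pi.
exact: raddfB.
Qed.

HB.instance Definition _ := GRing.isZmodMorphism.Build
  {ideal_quot I} {ideal_quot J} (quot_map sIJ) quot_map_zmod_morphism.

End QuotientMap.

Section Diagram.
Variables (A : zmodType) (K : finType) (I : K -> zmodClosed A).

Definition quot_bigcap : zmodType := {ideal_quot subg_bigcap I}.

Definition quot_prod : zmodType := zprod (fun k : K => {ideal_quot I k}).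

Definition quot_sum_prod : zmodType :=
  zprod (fun p : K * K => {ideal_quot subg_sum (I p.1) (I p.2)}).

Definition diag_in (x : quot_bigcap) : quot_prod :=
  fun k => quot_map (@subg_bigcap_sub A K I k) x.

Definition diag_fst (x : quot_prod) : quot_sum_prod :=
  fun p => quot_map (@subg_sum_subl A (I p.1) (I p.2)) (x p.1).

Definition diag_snd (x : quot_prod) : quot_sum_prod :=
  fun p => quot_map (@subg_sum_subr A (I p.1) (I p.2)) (x p.2).

Lemma diag_inE (a : A) :
  diag_in (\pi_({ideal_quot subg_bigcap I}) a)
    = fun k => \pi_({ideal_quot I k}) a.
Proof. by apply: functional_extensionality_dep => k; apply: quot_map_pi. Qed.

Lemma diag_fstE (a : K -> A) :
  diag_fst (fun k => \pi_({ideal_quot I k}) (a k))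
    = fun p => \pi_({ideal_quot subg_sum (I p.1) (I p.2)}) (a p.1).
Proof. by apply: functional_extensionality_dep => p; apply: quot_map_pi. Qed.

Lemma diag_sndE (a : K -> A) :
  diag_snd (fun k => \pi_({ideal_quot I k}) (a k))
    = fun p => \pi_({ideal_quot subg_sum (I p.1) (I p.2)}) (a p.2).
Proof. by apply: functional_extensionality_dep => p; apply: quot_map_pi. Qed.

Lemma diag_in_zmod_morphism : zmod_morphism diag_in.
Proof. by move=> x y; apply: functional_extensionality_dep => k; apply: raddfB. Qed.

Lemma diag_fst_zmod_morphism : zmod_morphism diag_fst.
Proof. by move=> x y; apply: functional_extensionality_dep => p; apply: raddfB. Qed.

Lemma diag_snd_zmod_morphism : zmod_morphism diag_snd.
Proof. by move=> x y; apply: functional_extensionality_dep => p; apply: raddfB. Qed.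

HB.instance Definition _ := GRing.isZmodMorphism.Build
  quot_bigcap quot_prod diag_in diag_in_zmod_morphism.
HB.instance Definition _ := GRing.isZmodMorphism.Build
  quot_prod quot_sum_prod diag_fst diag_fst_zmod_morphism.
HB.instance Definition _ := GRing.isZmodMorphism.Build
  quot_prod quot_sum_prod diag_snd diag_snd_zmod_morphism.

End Diagram.

Arguments diag_in {A K} I x.
Arguments diag_fst {A K} I x.
Arguments diag_snd {A K} I x.

(* Main.v *)
Require Import Defs.
From HB Require Import structures.
From mathcomp Require Import all_boot all_algebra.
From mathcomp Require Import boolp classical_sets.

(** The diagram is an equalizer as soon as its first arrow is injective with
    image the set of families on which the parallel arrows agree
    ([is_equalizerI]). Injectivity holds since the kernel of
    [A -> \prod_k A / I k] is the intersection of the [I k]. The statement about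
    the image is a Chinese remainder theorem: if [a i - a j \in I i + I j] for
    all [i], [j], then some [b] satisfies [b - a k \in I k] for all [k]
    ([chinese_remainder]).

    The remainder theorem is proved by adding one congruence at a time. Let [b]
    solve the congruences indexed by [s], let [J] be the intersection of the
    [I j] for [j] in [s], and let [k] be a new index. For each [j] in [s],
    [b - a k = (b - a j) + (a j - a k)] lies in [I k + I j]. Distributivity says
    that the intersection of all the [I k + I j] is [I k + J]
    ([mem_sum_seq_cap]), so [b - a k = y + z] with [y] in [I k] and [z] in [J].
    Then [b - z = a k + y] solves the new congruence, and still solves the old
    ones because [z] lies in every [I j]. *)

Set Implicit Arguments.
Unset Strict Implicit.
Unset Printing Implicit Defensive.

Import GRing.Theory.
Local Open Scope ring_scope.
Local Open Scope quotient_scope.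

Section ChineseRemainder.
Variables (A : zmodType) (L : set (zmodClosed A)).
Hypotheses (latL : subgroup_lattice L) (distrL : distributive_lattice L).
Variables (K : eqType) (I : K -> zmodClosed A).
Hypothesis IL : forall k, L (I k).

(** The intersection over a nonempty list [k0 :: s] of indices: the whole group,
    which would be the empty intersection, need not belong to [L]. *)
Definition seq_cap (k0 : K) (s : seq K) : zmodClosed A :=
  foldr (fun k J => subg_cap (I k) J) (I k0) s.

Lemma seq_cap_lattice k0 s : L (seq_cap k0 s).
Proof. by elim: s => [|k s IHs] //=; apply: latL.1. Qed.

Lemma seq_cap_sub k0 s k : k \in k0 :: s -> {subset seq_cap k0 s <= I k}.
Proof.
elim: s => [|j s IHs] /=; first by rewrite mem_seq1 => /eqP->.
rewrite !inE orbCA => /orP[/eqP-> | k_s] x /andP[xj xs] //.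
by apply: IHs xs; rewrite inE.
Qed.

Lemma mem_sum_seq_cap (H : zmodClosed A) k0 s (x : A) : L H ->
  (forall k, k \in k0 :: s -> x \in subg_sum H (I k)) ->
  x \in subg_sum H (seq_cap k0 s).
Proof.
move=> LH; elim: s => [|j s IHs] xHI /=; first exact/xHI/mem_head.
rewrite (distrL LH (IL j) (seq_cap_lattice k0 s)).
apply/andP; split; first by apply: xHI; rewrite !inE eqxx orbT.
apply: IHs => k k_s; apply: xHI; move: k_s.
by rewrite !inE orbCA => ->; rewrite orbT.
Qed.

Lemma chinese_remainder_seq (a : K -> A) k0 s :
  (forall i j, a i - a j \in subg_sum (I i) (I j)) ->
  exists b, forall k, k \in k0 :: s -> b - a k \in I k.
Proof.
move=> compat_a; elim: s => [|k s [b b_s]].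
  by exists (a k0) => k; rewrite mem_seq1 => /eqP->; rewrite subrr rpred0.
have /asboolP[y [z [y_k z_s def_yz]]] :
    b - a k \in subg_sum (I k) (seq_cap k0 s).
  apply: mem_sum_seq_cap (IL k) _ => j j_s.
  rewrite -(subrKA (a j)) rpredD //; first exact/subg_sum_subr/b_s.
  by rewrite -opprB rpredN.
exists (b - z) => j; rewrite !inE orbCA => /orP[/eqP-> | j_s].
  by rewrite addrAC def_yz addrK.
by rewrite addrAC rpredB ?b_s //; apply: seq_cap_sub z_s.
Qed.

End ChineseRemainder.

Lemma chinese_remainder (A : zmodType) (L : set (zmodClosed A))
    (K : finType) (I : K -> zmodClosed A) (a : K -> A) :
  subgroup_lattice L -> distributive_lattice L -> (forall k, L (I k)) ->
  (forall i j, a i - a j \in subg_sum (I i) (I j)) ->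
  exists b, forall k, b - a k \in I k.
Proof.
move=> latL distrL IL compat_a.
have [k0 _ | K0] := pickP (@predT K); last by exists 0 => k; have := K0 k.
have [b b_K] := chinese_remainder_seq latL distrL IL k0 (enum K) compat_a.
by exists b => k; apply: b_K; rewrite inE mem_enum orbT.
Qed.

(** The factorization of [h] is obtained by choosing preimages under [e];
    injectivity of [e] makes that choice unique, hence additive. *)
Lemma is_equalizerI (E X Y : zmodType) (e : {additive E -> X})
    (f g : {additive X -> Y}) :
  f \o e =1 g \o e -> injective e ->
  (forall x, f x = g x -> exists u, e u = x) -> is_equalizer e f g.
Proof.
move=> fe_ge inj_e im_e; split=> // T h fh_gh.
pose k t := projT1 (cid (im_e (h t) (fh_gh t))).
have ekE t : e (k t) = h t by rewrite /k; case: cid.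
have k_morph : zmod_morphism k.
  by move=> t u; apply: inj_e; rewrite raddfB !ekE raddfB.
pose kM := GRing.isZmodMorphism.Build T E k k_morph.
pose kA : {additive T -> E} := HB.pack k kM.
exists kA => // k' ek' t.
by apply: inj_e; rewrite [LHS]ek' [RHS]ekE.
Qed.

Section Diagram.
Variables (A : zmodType) (K : finType) (I : K -> zmodClosed A).

Lemma quot_bigcapW (P : quot_bigcap I -> Prop) :
  (forall a, P (\pi_({ideal_quot subg_bigcap I}) a)) -> forall x, P x.
Proof. by move=> Ppi x; have := Ppi (repr x); rewrite reprK. Qed.

Lemma diag_in_equalizes : diag_fst I \o diag_in I =1 diag_snd I \o diag_in I.
Proof.
elim/quot_bigcapW => a /=.
by rewrite diag_inE (diag_fstE I (fun=> a)) (diag_sndE I (fun=> a)).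
Qed.

Lemma diag_in_inj : injective (diag_in I).
Proof.
elim/quot_bigcapW => a; elim/quot_bigcapW => b; rewrite !diag_inE => eq_ab.
apply/eqP; rewrite -Quotient.idealrBE; apply/forallP => k.
by rewrite Quotient.idealrBE; apply/eqP; have /(congr1 (@^~ k)) := eq_ab.
Qed.

Lemma quot_prod_repr (x : quot_prod I) :
  x = (fun k => \pi_({ideal_quot I k}) (repr (x k))).
Proof. by apply: functional_extensionality_dep => k; rewrite reprK. Qed.

Lemma diag_fst_snd_compat (a : K -> A) :
  diag_fst I (fun k => \pi_({ideal_quot I k}) (a k))
    = diag_snd I (fun k => \pi_({ideal_quot I k}) (a k)) ->
  forall i j, a i - a j \in subg_sum (I i) (I j).
Proof.
rewrite diag_fstE diag_sndE => eq_a i j.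
by rewrite Quotient.idealrBE; apply/eqP; have /(congr1 (@^~ (i, j))) := eq_a.
Qed.

End Diagram.

Theorem corollary5 (A : zmodType) (L : set (zmodClosed A))
    (latL : subgroup_lattice L) (distrL : distributive_lattice L)
    (n : nat) (I : 'I_n.+1 -> zmodClosed A) (IL : forall k, L (I k)) :
  is_equalizer (diag_in I) (diag_fst I) (diag_snd I).
Proof.
apply: is_equalizerI; [exact: diag_in_equalizes | exact: diag_in_inj |].
move=> x; rewrite [x]quot_prod_repr => /diag_fst_snd_compat compat_x.
have [b bP] := chinese_remainder latL distrL IL compat_x.
exists (\pi_({ideal_quot subg_bigcap I}) b); rewrite /= diag_inE.
apply: functional_extensionality_dep => k.
by apply/eqP; rewrite -Quotient.idealrBE; apply: bP.
Qed.
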